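(* Let $m$ and $n$ be positive integers with $m\le n+1$, and define $\delta = n-m+1$. Suppose there exists an orthogonal array $\mathrm{OA}(m,n)$. If $n > \frac{8}{3}\delta^3 - \frac{16}{3}\delta^2 + 2\delta + \frac{2}{3}$, then the orthogonal array can be extended to a full orthogonal array; that is, rows can be added to the given $\mathrm{OA}(m,n)$ so as to obtain an $\mathrm{OA}(n+1,n)$.
   Context: An orthogonal array $\mathrm{OA}(m,n)$ is an $m\times n^2$ array with entries from an $n$-element set such that, for any two rows, the $n^2$ ordered pairs formed by them are all distinct. A full orthogonal array is an $\mathrm{OA}(n+1,n)$. The number $\delta=n-m+1$ is the deficiency of the $\mathrm{OA}(m,n)$, i.e. the number of rows missing from a full orthogonal array. *)

(* Defs.v *)
From mathcomp Require Import all_boot all_order all_algebra.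

Set Implicit Arguments.
Unset Strict Implicit.
Unset Printing Implicit Defensive.

(* [A] is an OA(m, n) with symbol set [T].  Injectivity of the map sending a
   column to the ordered pair of its entries in rows [i] and [j] says that the
   n ^ 2 ordered pairs formed by these two rows are all distinct. *)
Definition orthogonal_array (T : finType) (m n : nat) (A : 'M[T]_(m, n ^ 2)) :
    Prop :=
  #|T| = n /\
  forall i j : 'I_m, i != j -> injective (fun c : 'I_(n ^ 2) => (A i c, A j c)).

Arguments orthogonal_array {T m} n A.

(* Main.v *)
Require Import Defs.
From mathcomp Require Import all_boot all_order all_algebra.
From mathcomp Require Import zify ring lra.

Set Implicit Arguments.
Unset Strict Implicit.
Unset Printing Implicit Defensive.

(** Let [d] be the deficiency.  It is enough to add one row: the deficiency drops
    by one, and the hypothesis, read as [3n > 8d^3 - 16d^2 + 6d + 2], is inherited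
    by [d - 1].

    Join two columns when they agree in no row.  A new row is a partition of the
    [n ^ 2] columns into [n] cliques of size [n] of this graph.  The graph has
    degree [d(n - 1)]; adjacent vertices have exactly
    [lam = n - 2 + (d - 1)(d - 2)] common neighbours, and distinct non-adjacent
    ones have exactly [d(d - 1)].  The cliques come from an argument of Bruck, Bose
    and Metsch.  Put [M = floor((4d - 1) / 3)] and [mu = d(d - 1)].

    - A claw at [p] is an independent set of neighbours of [p].  By the second
      Bonferroni inequality the degree is too small for a claw of size [M + 1]
      ([claw_bound]).
    - A line is a maximal clique with at least [lam + 2 - (M - 1)(mu - 1)]
      vertices.  The size of [lam] makes two lines share at most one vertex
      ([line_meet]).  A greedy choice of points on the lines through [p] gives a
      claw, so there are at most [M] lines through [p] ([few_lines]).  If some edge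
      at [p] lay on no line, a largest claw among those that meet all lines at [p]
      and contain an uncovered neighbour [y] would show that [y] and the neighbours
      of [p] adjacent to [y] but to no other vertex of the claw form a large
      clique, hence a line through [p] and [y] ([edge_line]).
    - For an edge on a line [L], the common neighbours outside [L] are determined
      by the two lines joining them to the ends, so [lam <= #|L| - 2 + (M - 1)^2]
      ([lam_line]).  As every clique has at most [n] vertices, counting the
      neighbours of [p] line by line leaves only one possibility: [d] lines through
      [p], each of size [n] ([lines_at_full]).
    - A line [L] of size [n] meets every fibre of every row exactly once, so a
      vertex off [L] has [d - 1] neighbours on [L], on as many different lines.
      Exactly one of its [d] lines therefore misses [L] ([one_parallel]).  The
      lines that are equal to [L] or disjoint from [L] partition the columns, and
      they are the fibres of the new row. *)

(** * Cardinality of finite unions *)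

Lemma exists_subset_card (I : finType) (S : {set I}) t : t <= #|S| ->
  exists2 S' : {set I}, S' \subset S & #|S'| = t.
Proof.
move=> leS; exists [set x in take t (enum S)].
  by apply/subsetP=> x; rewrite inE => /mem_take; rewrite mem_enum.
rewrite cardsE (card_uniqP _) ?take_uniq ?enum_uniq // size_take -cardE.
by case: ltngtP leS.
Qed.

Lemma leq_card_bigcup (I V : finType) (A : I -> {set V}) (S : {set I}) (c : nat) :
    (forall q, q \in S -> #|A q| <= c) -> #|\bigcup_(q in S) A q| <= #|S| * c.
Proof.
move=> leA; rewrite -sum_nat_const.
apply: (@leq_trans (\sum_(q in S) #|A q|)); last exact: leq_sum.
elim/big_rec2: _ => [|r b B _ leB]; first by rewrite cards0.
by rewrite (leq_trans (leq_card_setU _ _).1) ?leq_add2l.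
Qed.

(** The second Bonferroni inequality, with uniform bounds on the sizes of the sets
    and of their pairwise intersections. *)
Lemma bonferroni (I V : finType) (A : I -> {set V}) (S : {set I}) (a c : nat) :
    (forall q, q \in S -> a <= #|A q|) ->
    (forall q r, q \in S -> r \in S -> q != r -> #|A q :&: A r| <= c) ->
  #|S| * a <= #|\bigcup_(q in S) A q| + 'C(#|S|, 2) * c.
Proof.
have [t] := ubnP #|S|; elim: t S => // t IH S leSt geA leA.
have [-> | [q qS]] := set_0Vmem S; first by rewrite cards0.
have cS : #|S| = #|S :\ q|.+1 by rewrite (cardsD1 q) qS.
have /IH {}IH : #|S :\ q| < t by rewrite -ltnS -cS.
have sub r : r \in S :\ q -> r \in S by case/setD1P.
have {IH} := IH (fun r rS => geA r (sub r rS))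
  (fun r r' rS r'S => leA r r' (sub r rS) (sub r' r'S)).
rewrite cS (big_setD1 q qS) /= binS bin1 cardsU.
set U := \bigcup_(r in S :\ q) A r => IH.
have leU : #|A q :&: U| <= #|S :\ q| * c.
  rewrite big_distrr /=; apply: leq_card_bigcup => r /setD1P[neq_rq rS].
  by apply: leA => //; rewrite eq_sym.
have := geA q qS; have := subset_leq_card (subsetIl (A q) U).
by move: IH leU; nia.
Qed.

(** * Claws and lines in a graph with few common neighbours *)

(** Adjacent vertices have [lam] common neighbours, and distinct non-adjacent ones
    at most [c + 1].  The bound on the size of claws is [s + 1]. *)
Section Lines.

Variables (V : finType) (adj : rel V) (lam c s : nat).
Hypothesis adjC : symmetric adj.
Hypothesis adjxx : irreflexive adj.

(** The open neighbourhood of [x]. *)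
Definition nbrs x := [set y | adj x y].

Hypothesis lamP : forall x y, adj x y -> #|nbrs x :&: nbrs y| = lam.
Hypothesis cP : forall x y, x != y -> ~~ adj x y ->
  #|nbrs x :&: nbrs y| <= c.+1.
Hypothesis lam_big : (s + s.+1) * c <= lam.
Hypothesis deg_small : forall x, #|nbrs x| + 'C(s.+2, 2) * c < s.+2 * lam.+1.

(** Sets of pairwise adjacent vertices. *)
Definition clique (C : {set V}) :=
  [forall x in C, forall y in C, (x != y) ==> adj x y].

(** Maximal cliques with at least [lam + 2 - s * c] vertices. *)
Definition line (L : {set V}) := maxset clique L && (lam.+2 <= #|L| + s * c).

(** The lines through [p]. *)
Definition lines_at p := [set L : {set V} | line L & p \in L].

(** [S] is an independent set of neighbours of [p].  Irreflexivity of [adj] makes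
    it harmless that [x] and [y] may coincide. *)
Definition claw p (S : {set V}) :=
  (S \subset nbrs p) && [forall x in S, forall y in S, ~~ adj x y].

Lemma adj_neq x y : adj x y -> x != y.
Proof. by apply: contraTneq => ->; rewrite adjxx. Qed.

Lemma cliqueP (C : {set V}) :
  reflect {in C &, forall x y, x != y -> adj x y} (clique C).
Proof.
apply: (iffP 'forall_in_'forall_in_implyP) => H x xC y yC; apply: H => //.
Qed.

Lemma clawP p (S : {set V}) :
  reflect ({in S, forall x, adj p x} /\ {in S &, forall x y, ~~ adj x y})
          (claw p S).
Proof.
apply: (iffP andP) => [[/subsetP sS /'forall_in_forall_inP H]|[sS H]].
  by split=> [x /sS|x y xS yS]; [rewrite inE | apply: H].
split; first by apply/subsetP=> x /sS; rewrite inE.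
by apply/'forall_in_forall_inP => x xS y yS; apply: H.
Qed.

Lemma line_clique L : line L -> {in L &, forall x y, x != y -> adj x y}.
Proof. by case/andP=> /maxsetp/cliqueP. Qed.

Lemma line_nonadj L q : line L -> q \notin L ->
  exists2 y, y \in L & (y != q) && ~~ adj y q.
Proof.
move=> lL qL; apply/exists_inP; apply: contraR qL.
rewrite negb_exists_in => /forall_inP H.
case/andP: (lL) => /maxsetP[/cliqueP cL maxL] _.
rewrite -(maxL (q |: L)) ?setU11 ?subsetUr //.
have H' y : y \in L -> y != q -> adj y q.
  by move=> /H + yq; rewrite yq negbK.
apply/cliqueP=> x y /setU1P[->|xL] /setU1P[->|yL]; rewrite ?eqxx //.
- by rewrite eq_sym adjC; apply: H'.
- by apply: H'.
- by apply: cL.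
Qed.

(** A maximal clique not containing [q] has a vertex not adjacent to [q]; the
    neighbours of [q] on the clique are common neighbours of the two. *)
Lemma nbrs_line L q : line L -> q \notin L -> #|nbrs q :&: L| <= c.+1.
Proof.
move=> lL qL; have [y yL /andP[yq nyq]] := line_nonadj lL qL.
apply: leq_trans (cP _ nyq) => //; apply/subset_leq_card/subsetP => z.
rewrite !inE => /andP[qz zL]; rewrite qz andbT (line_clique lL) //.
by apply: contraNneq nyq => ->; rewrite adjC.
Qed.

(** If the two lines were distinct, their union minus [p] and [q] would consist of
    common neighbours of [p] and [q], while their intersection has at most [c + 1]
    vertices; this is too much for [lam] common neighbours. *)
Lemma line_meet L1 L2 p q : line L1 -> line L2 -> p != q ->
  p \in L1 -> q \in L1 -> p \in L2 -> q \in L2 -> L1 = L2.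
Proof.
move=> l1 l2 pq p1 q1 p2 q2.
have [sL12 | /subsetPn[y y1 y2]] := boolP (L1 \subset L2).
  case/andP: l1 => /maxsetP[_ max1] _; case/andP: l2 => /maxsetP[c2 _] _.
  by rewrite (max1 L2).
have leI : #|L1 :&: L2| <= c.+1.
  apply: leq_trans (nbrs_line l2 y2); apply/subset_leq_card/subsetP => z.
  rewrite !inE => /andP[z1 z2]; rewrite z2 andbT (line_clique l1) //.
  by apply: contraNneq y2 => ->.
have leU : #|L1 :|: L2| <= lam.+2.
  rewrite (cardsD1 p) (cardsD1 q) !inE p1 q1 eq_sym pq /= !add1n !ltnS.
  rewrite -(lamP (line_clique l1 p1 q1 pq)) subset_leq_card //.
  apply/subsetP=> z; rewrite !inE ![z == _]eq_sym.
  by case/and3P=> qz pz /orP[zL|zL]; rewrite !(line_clique _ _ zL).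
have [/andP[_ c1] /andP[_ c2]] := (l1, l2).
by have := cardsUI L1 L2; move: lam_big leI leU c1 c2; nia.
Qed.

Lemma sub_claw p (S S' : {set V}) : S' \subset S -> claw p S -> claw p S'.
Proof.
move=> /subsetP sS /clawP[pS nS]; apply/clawP.
by split=> [x /sS /pS|x y /sS xS /sS yS] //; apply: nS.
Qed.

Lemma claw_add p q S : claw p S -> adj p q ->
  {in S, forall x, ~~ adj x q} -> claw p (q |: S).
Proof.
move=> /clawP[pS nS] pq nqS; apply/clawP; split=> [x /setU1P[->|/pS]|x y] //.
case/setU1P=> [->|xS] /setU1P[->|yS]; rewrite ?adjxx ?nqS //.
  by rewrite adjC nqS.
exact: nS.
Qed.

(** The closed neighbourhoods, within [nbrs p], of the vertices of a claw at [p]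
    have [lam + 1] elements each and meet pairwise in at most [c] elements, [p]
    itself being the remaining common neighbour. *)
Lemma claw_bound p S : claw p S -> #|S| <= s.+1.
Proof.
move=> clS; rewrite leqNgt; apply/negP => gtS.
have [S' /sub_claw/(_ clS)/clawP[pS nS] cS'] := exists_subset_card gtS.
pose A q := q |: (nbrs p :&: nbrs q).
have geA q : q \in S' -> lam.+1 <= #|A q|.
  by move=> qS; rewrite cardsU1 lamP ?pS // !inE adjxx andbF.
have leA q r : q \in S' -> r \in S' -> q != r -> #|A q :&: A r| <= c.
  move=> qS rS qr; have nqr := nS _ _ qS rS.
  rewrite -ltnS; apply: leq_trans (cP qr nqr).
  rewrite (cardsD1 p (nbrs q :&: nbrs r)) !inE !(adjC _ p) !pS //= add1n ltnS.
  apply/subset_leq_card/subsetP=> z; rewrite !inE.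
  case/andP=> /predU1P[-> | /andP[pz qz]] /predU1P[e | /andP[pz' rz]].
  - by rewrite e eqxx in qr.
  - by rewrite adjC (negPf nqr) in rz.
  - by rewrite e (negPf nqr) in qz.
  - by rewrite qz rz eq_sym (adj_neq pz).
have := bonferroni geA leA; rewrite cS'.
suff /subset_leq_card : \bigcup_(q in S') A q \subset nbrs p.
  by have := deg_small p; lia.
apply/bigcupsP=> q /pS pq; apply/subsetP=> z; rewrite !inE.
by case/predU1P=> [-> //|/andP[]].
Qed.

Lemma line_size L : line L -> s.+1 * c < #|L|.-1.
Proof. by case/andP=> _; move: lam_big; nia. Qed.

(** A claw that avoids a family of lines through [p] extends to one that meets all
    of them, by choosing one point on each line greedily: at each step the points
    already chosen exclude at most [(s + 1) * c] points other than [p]. *)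
Lemma claw_extend p (Ls : {set {set V}}) (S : {set V}) :
    Ls \subset lines_at p -> claw p S -> #|S| + #|Ls| <= s.+2 ->
    (forall L, L \in Ls -> S :&: L = set0) ->
  exists S' : {set V}, [/\ claw p S', S \subset S', #|S'| = #|S| + #|Ls| &
    forall L, L \in Ls -> S' :&: L != set0].
Proof.
have [t] := ubnP #|Ls|; elim: t Ls S => // t IH Ls S ltL sL clS leS dS.
have [L0 | [L LLs]] := set_0Vmem Ls.
  by exists S; rewrite L0 cards0 addn0; split=> // L; rewrite inE.
have cL : #|Ls| = #|Ls :\ L|.+1 by rewrite (cardsD1 L) LLs.
have /[!inE] /andP[lL pL] := subsetP sL L LLs.
have [pS nS] := clawP _ _ clS.
have [q] : exists q, q \in (L :\ p) :\: \bigcup_(x in S) (nbrs x :&: L :\ p).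
  apply/set0Pn; rewrite -card_gt0 cardsD subn_gt0.
  apply: (@leq_ltn_trans (#|S| * c)).
    apply: leq_trans (subset_leq_card (subsetIr _ _)) _.
    apply: leq_card_bigcup => x xS.
    have xL : x \notin L.
      apply/negP=> xL; move/setP/(_ x): (dS L LLs).
      by rewrite !inE xS xL.
    have := nbrs_line lL xL; rewrite (cardsD1 p) !inE pL adjC pS //.
  have := line_size lL; rewrite (cardsD1 p L) pL add1n /=; apply: leq_ltn_trans.
  by rewrite leq_mul2r -ltnS; move: leS; rewrite cL; lia.
rewrite 3!inE => /andP[nbq /andP[qp qL]].
have nqS x : x \in S -> ~~ adj x q.
  move=> xS; apply: contra nbq => xq; apply/bigcupP; exists x => //.
  by rewrite !inE xq qL qp.
have qS : q \notin S.
  apply/negP=> qS; move/setP/(_ q): (dS L LLs).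
  by rewrite !inE qS qL.
have pq : adj p q by apply: line_clique lL _ _ pL qL _; rewrite eq_sym.
have clqS : claw p (q |: S) by apply: claw_add.
have [|||||S' [clS' sS' cS' mS']] := IH (Ls :\ L) (q |: S).
- by rewrite -ltnS -cL.
- by apply: subset_trans sL; apply: subsetDl.
- exact: clqS.
- by rewrite cardsU1 qS add1n addSn -addnS -cL.
- move=> L' /setD1P[L'L L'Ls]; have /[!inE] /andP[lL' pL'] := subsetP sL _ L'Ls.
  apply/setP=> x; rewrite !inE; apply/negP=> /andP[/predU1P[->|xS] xL'].
    by case/eqP: L'L; apply: line_meet lL' lL _ pL' xL' pL qL; rewrite eq_sym.
  by move/setP/(_ x): (dS L' L'Ls); rewrite !inE xS xL'.
exists S'; split=> //.
- by apply: subset_trans sS'; apply: subsetUr.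
- by rewrite cS' cardsU1 qS cL add1n addSn addnS.
- move=> L' L'Ls; have [-> | L'L] := eqVneq L' L; last first.
    by apply: mS'; rewrite !inE L'L.
  by apply/set0Pn; exists q; rewrite inE qL (subsetP sS') ?setU11.
Qed.

Lemma few_lines p : #|lines_at p| <= s.+1.
Proof.
rewrite leqNgt; apply/negP=> gtL.
have [Ls sLs cLs] := exists_subset_card gtL.
have cl0 : claw p set0 by apply/clawP; split=> x; rewrite inE.
have [||S [/claw_bound]] := claw_extend sLs cl0.
- by rewrite cards0 cLs.
- by move=> L _; rewrite set0I.
- by rewrite cards0 cLs => le _ e; rewrite e ltnn in le.
Qed.

Lemma line_extend C : clique C -> lam.+2 <= #|C| + s * c ->
  exists2 L, line L & C \subset L.
Proof.
move=> /maxset_exists[L maxL sCL] leC; exists L => //; rewrite /line maxL.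
by rewrite (leq_trans leC) ?leq_add2r ?subset_leq_card.
Qed.

(** The heart of the matter: every edge lies on a line.  [U] is the set of
    neighbours of [p] on no line through [p]; it is shown to be empty by means of a
    claw [S] of largest size among those that meet [U] and every line through
    [p]. *)
Lemma edge_line p x : adj p x -> exists L, [/\ line L, p \in L & x \in L].
Proof.
move=> px; pose U := nbrs p :\: cover (lines_at p).
have [xU | ] := boolP (x \in U); last first.
  rewrite !inE px andbT negbK => /bigcupP[L /[!inE] /andP[lL pL] xL].
  by exists L.
have notU y L : y \in U -> L \in lines_at p -> y \notin L.
  rewrite inE => /andP[/bigcupP yU _] LL; apply/negP=> yL; apply: yU.
  by exists L.
pose full (S : {set V}) := [&& claw p S, S :&: U != set0 &
  [forall L in lines_at p, S :&: L != set0]].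
have [S0 fullS0] : exists S, full S.
  have cl1 : claw p [set x].
    by apply/clawP; split=> [y /set1P -> //|y z /set1P -> /set1P ->]; rewrite adjxx.
  have [||S [clS sS _ mS]] := claw_extend (subxx (lines_at p)) cl1.
  - by rewrite cards1 add1n ltnS few_lines.
  - move=> L LL; apply/setP=> y; rewrite !inE; apply/negP=> /andP[/eqP-> xL].
    by have := notU _ _ xU LL; rewrite xL.
  exists S; apply/and3P; split=> //; last by apply/forall_inP.
  by apply/set0Pn; exists x; rewrite inE xU (subsetP sS) ?set11.
have [S fullS maxS] := arg_maxnP (fun S : {set V} => #|S|) fullS0.
case/and3P: fullS => clS /set0Pn[y /setIP[yS yU]] /forall_inP mS.
have [pS nS] := clawP _ _ clS.
(* [C]: the vertices that only [y] dominates in the claw. They avoid every line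
   at [p], since each such line contains a vertex of the claw other than [y]. *)
pose near z := (z == y) || adj y z.
pose C := [set z in nbrs p | near z & [forall q in S :\ y, ~~ adj q z]].
have CU z : z \in C -> z \in U.
  rewrite !inE => /and3P[pz nearz /forall_inP nz]; rewrite pz andbT.
  apply/bigcupP=> -[L LL zL]; have /set0Pn[q /setIP[qS qL]] := mS L LL.
  have /[!inE] /andP[lL pL] := LL.
  have qy : q \in S :\ y.
    by rewrite !inE qS andbT; apply: contraTneq qL => ->; apply: notU.
  have [eqz | qz] := eqVneq q z; last first.
    by have := nz q qy; rewrite (line_clique lL qL zL qz).
  move: nearz qy; rewrite -eqz !inE => /predU1P[->|yq]; rewrite ?eqxx //.
  by rewrite (negPf (nS _ _ yS qS)) in yq.
(* Exchanging [y] for two non-adjacent vertices of [C] would enlarge [S]. *)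
have cliqueC : {in C &, forall z w, z != w -> adj z w}.
  move=> z w zC wC zw; apply/negPn/negP=> nzw.
  have notS v : v \in C -> v \notin S :\ y.
    rewrite !inE => /and3P[_ nearv _]; apply/negP=> /andP[vy vS].
    by move: nearv; rewrite /near (negPf vy) (negPf (nS _ _ yS vS)).
  have clS' : claw p (z |: (w |: S :\ y)).
    have nC v q : v \in C -> q \in S :\ y -> ~~ adj q v.
      by rewrite inE => /and3P[_ _ /forall_inP]; apply.
    have pC v : v \in C -> adj p v by rewrite !inE => /andP[].
    apply: claw_add; [apply: claw_add|exact: pC|]; first 1 last.
    - exact: pC.
    - by move=> v; apply: nC.
    - by move=> v /setU1P[->|]; [rewrite adjC | apply: nC].
    - by apply: sub_claw clS; apply: subsetDl.
  have : #|z |: (w |: S :\ y)| <= #|S|.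
    apply: maxS; apply/and3P; split=> //.
      by apply/set0Pn; exists z; rewrite !inE eqxx /=; have := CU _ zC; rewrite !inE.
    apply/forall_inP=> L LL; have /set0Pn[q /setIP[qS qL]] := mS L LL.
    apply/set0Pn; exists q; rewrite !inE qL qS !andbT.
    suff -> : q != y by rewrite !orbT.
    by apply: contraTneq qL => ->; apply: notU.
  rewrite !cardsU1 !inE -!in_setD1 !(negPf (notS _ _)) // orbF zw /=.
  by rewrite (cardsD1 y S) yS !add1n ltnn.
(* Among the [lam + 1] vertices of [nbrs p] that [y] dominates, each of the at most [s] other
   vertices of the claw dominates at most [c]. *)
have sizeC : lam.+1 <= #|C| + s * c.
  pose A := y |: (nbrs p :&: nbrs y).
  have cA : #|A| = lam.+1.
    by rewrite cardsU1 lamP ?pS // !inE adjxx andbF.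
  have sAC : A :\: \bigcup_(q in S :\ y) (A :&: nbrs q) \subset C.
    apply/subsetP=> z /setDP[zA /bigcupP nz].
    have -> : (z \in C) = (adj p z && near z) && [forall q in S :\ y, ~~ adj q z].
      by rewrite !inE andbA.
    apply/andP; split.
      by move: zA; rewrite /near !inE => /predU1P[->|/andP[-> ->]];
        rewrite ?eqxx ?pS ?orbT.
    apply/forall_inP=> q qS; apply/negP=> qz; case: nz; exists q => //.
    by rewrite inE zA inE.
  have := subset_leq_card sAC; rewrite cardsD cA.
  have leI q : q \in S :\ y -> #|A :&: nbrs q| <= c.
    case/setD1P=> qy qS; have nqy := nS _ _ yS qS.
    have yq : y != q by rewrite eq_sym.
    have := cP yq nqy; rewrite (cardsD1 p) !inE !(adjC _ p) !pS //= add1n ltnS.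
    apply: leq_trans; apply/subset_leq_card/subsetP=> z; rewrite !inE.
    case/andP=> /predU1P[-> qy'|/andP[pz yz] qz].
      by rewrite adjC (negPf nqy) in qy'.
    by rewrite yz qz eq_sym (adj_neq pz).
  have := @leq_card_bigcup _ _ (fun q => A :&: nbrs q) _ _ leI.
  have := subset_leq_card (subsetIr A (\bigcup_(q in S :\ y) (A :&: nbrs q))).
  have := claw_bound clS; rewrite (cardsD1 y S) yS; nia.
have yC : y \in C.
  rewrite !inE pS // /near eqxx /=; apply/forall_inP=> q /setD1P[_ qS].
  exact: nS.
have pC : p \notin C by rewrite !inE adjxx.
have [||L lL] := @line_extend (p |: C).
- apply/cliqueP=> z w /setU1P[->|zC] /setU1P[->|wC]; rewrite ?eqxx //.
  + by move: wC; rewrite !inE => /andP[].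
  + by move: zC; rewrite adjC !inE => /andP[].
  + exact: cliqueC.
- by rewrite cardsU1 pC add1n addSn ltnS.
rewrite subUset sub1set => /andP[pL /subsetP/(_ _ yC) yL].
have LL : L \in lines_at p by rewrite inE lL pL.
by have := notU y L yU LL; rewrite yL.
Qed.

(** The line joining two adjacent vertices; the default value [set0] is taken only
    when no line contains both. *)
Definition line_through p x : {set V} :=
  odflt set0 [pick L | [&& line L, p \in L & x \in L]].

Lemma line_throughP p x : adj p x ->
  [/\ line (line_through p x), p \in line_through p x
    & x \in line_through p x].
Proof.
move=> /edge_line[L [lL pL xL]]; rewrite /line_through.
by case: pickP => [M /and3P[] | /(_ L)]; rewrite ?lL ?pL ?xL.
Qed.

Lemma line_through_eq p x L : line L -> p \in L -> x \in L -> p != x ->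
  line_through p x = L.
Proof.
move=> lL pL xL px; have [lM pM xM] := line_throughP (line_clique lL pL xL px).
exact: line_meet lM lL px _ _ _ _.
Qed.

Lemma line_through_in p x : adj p x -> line_through p x \in lines_at p.
Proof. by move=> /line_throughP[lL pL _]; rewrite inE lL. Qed.

(** A common neighbour of [p] and [q] off [L] is the only common point of the lines
    that join it to [p] and to [q], and both lines differ from [L]. *)
Lemma lam_line L p q : line L -> p \in L -> q \in L -> p != q ->
  lam.+2 <= #|L| + #|lines_at p|.-1 * #|lines_at q|.-1.
Proof.
move=> lL pL qL pq.
have LLp : L \in lines_at p by rewrite inE lL.
have LLq : L \in lines_at q by rewrite inE lL.
pose R := (nbrs p :&: nbrs q) :\: L.
have leR : #|R| <= #|lines_at p :\ L| * #|lines_at q :\ L|.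
  rewrite -cardsX -(card_in_imset (f := fun z => (line_through p z, line_through q z))).
    apply/subset_leq_card/subsetP=> _ /imsetP[z + ->].
    rewrite !in_setD !in_setI ![_ \in nbrs _]inE => /andP[zL /andP[pz qz]].
    rewrite in_setX !in_setD1 !line_through_in // !andbT.
    have [[_ _ zp] [_ _ zq]] := (line_throughP pz, line_throughP qz).
    by apply/andP; split; apply: contraNneq zL => <-.
  move=> y z; rewrite !in_setD !in_setI ![_ \in nbrs _]inE.
  move=> /andP[yL /andP[py qy]] /andP[zL /andP[pz qz]] [eqp eqq].
  apply/eqP/negPn/negP => yz; move: yL.
  have [l1 p1 y1] := line_throughP py; have [_ _ z1] := line_throughP pz.
  have [l2 q2 y2] := line_throughP qy; have [_ _ z2] := line_throughP qz.
  rewrite -eqp in z1; rewrite -eqq in z2.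
  have e := line_meet l1 l2 yz y1 z1 y2 z2.
  rewrite -e in q2.
  by rewrite -(line_meet l1 lL pq p1 q2 pL qL) y1.
rewrite (cardsD1 L (lines_at p)) LLp (cardsD1 L (lines_at q)) LLq /=.
rewrite (cardsD1 p L) pL (cardsD1 q) !inE eq_sym pq qL /= !addSn !ltnS.
rewrite -(lamP (line_clique lL pL qL pq)) -(cardsID L) leq_add //.
apply/subset_leq_card/subsetP=> z; rewrite !inE => /andP[/andP[pz qz] ->].
by rewrite andbT ![z == _]eq_sym !adj_neq.
Qed.

Lemma deg_lines p : #|nbrs p| = \sum_(L in lines_at p) #|L|.-1.
Proof.
rewrite -sum1_card (eq_bigl (adj p)); last by move=> x; rewrite inE.
rewrite (partition_big (line_through p) (mem (lines_at p))) /=; last first.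
  exact: line_through_in.
apply: eq_bigr => L /[!inE] /andP[lL pL].
rewrite sum1dep_card (cardsD1 p L) pL /=; apply: eq_card => x; rewrite !inE.
apply/andP/andP=> [[px /eqP<-]|[xp xL]].
  by have [_ _ ->] := line_throughP px; rewrite eq_sym adj_neq.
rewrite eq_sym in xp.
by rewrite (line_clique lL pL xL xp) (line_through_eq lL pL xL xp).
Qed.

(** From here on the graph has degree [d * (n - 1)] and its cliques have at most
    [n] vertices. *)
Variables (n d : nat).
Hypothesis n_gt1 : 1 < n.
Hypothesis deg_eq : forall x, #|nbrs x| = d * n.-1.
Hypothesis clique_le : forall C, clique C -> #|C| <= n.
Hypothesis d_small : d * n.-1 + d.+1 * s ^ 2 < d.+1 * lam.+1.

Lemma line_ge L : line L -> lam.+1 <= #|L|.-1 + s ^ 2.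
Proof.
move=> lL; have := line_size lL.
have [-> | [p pL]] := set_0Vmem L; first by rewrite cards0.
have [L0 | [q qL]] := set_0Vmem (L :\ p).
  by rewrite (cardsD1 p) pL L0 cards0.
case/setD1P: qL => qp qL _; rewrite eq_sym in qp.
have := lam_line lL pL qL qp; rewrite -[#|L|]prednK; last first.
  by apply/card_gt0P; exists p.
rewrite addSn ltnS => /leq_trans-> //; rewrite leq_add2l -mulnn leq_mul //.
  by have := few_lines p; case: #|_|.
by have := few_lines q; case: #|_|.
Qed.

(** The degree [d * (n - 1)] of [p] is the sum of the numbers [#|L| - 1].  As these
    exceed [d * (n - 1) / (d + 1)] there are at most [d] of them, and as they are
    at most [n - 1] there are at least [d]; so all equal [n - 1]. *)
Lemma lines_at_full p :
  #|lines_at p| = d /\ {in lines_at p, forall L : {set V}, #|L| = n}.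
Proof.
have cE := deg_lines p; rewrite deg_eq in cE.
have leL L : L \in lines_at p -> #|L|.-1 <= n.-1.
  rewrite inE => /andP[/andP[/maxsetp/clique_le leLn _] _].
  by rewrite -!subn1 leq_sub2r.
have le_d : #|lines_at p| <= d.
  rewrite leqNgt; apply/negP=> gt_d.
  have : #|lines_at p| * (lam.+1 - s ^ 2) <= d * n.-1.
    rewrite cE -sum_nat_const; apply: leq_sum => L /[!inE] /andP[lL _].
    by rewrite leq_subLR addnC line_ge.
  apply/negP; rewrite -ltnNge.
  apply: (@leq_trans (d.+1 * (lam.+1 - s ^ 2))); last by rewrite leq_mul2r gt_d orbT.
  by rewrite mulnBr ltn_subRL addnC.
have n1 : 0 < n.-1 by case: (n) n_gt1 => [|[]].
have sub_le : \sum_(L in lines_at p) (n.-1 - #|L|.-1) =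
    #|lines_at p| * n.-1 - d * n.-1.
  by rewrite cE sumnB // sum_nat_const.
have ge_d : d <= #|lines_at p|.
  by rewrite -(leq_pmul2r n1) cE -sum_nat_const leq_sum.
have eq_d : #|lines_at p| = d by apply/eqP; rewrite eqn_leq le_d.
split=> // L LL; move: sub_le; rewrite eq_d subnn => /eqP.
rewrite sum_nat_eq0 => /forall_inP/(_ L LL); rewrite subn_eq0 => geL.
have eqL : #|L|.-1 = n.-1 by apply/eqP; rewrite eqn_leq leL.
move: LL; rewrite inE => /andP[_ pL].
rewrite -(prednK (ltnW n_gt1)) -eqL prednK //.
by apply/card_gt0P; exists p.
Qed.

Hypothesis off_line :
  forall L p, line L -> #|L| = n -> p \notin L -> #|nbrs p :&: L| = d.-1.
Hypothesis d_gt0 : 0 < d.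

(** Among the [d] lines through [p], those meeting [L] are the lines joining [p] to
    its [d - 1] neighbours on [L]. *)
Lemma one_parallel L p : line L -> p \notin L ->
  #|[set M in lines_at p | [disjoint M & L]]| = 1.
Proof.
move=> lL pL.
have cL : #|L| = n.
  have := line_size lL; have [-> | [q qL]] := set_0Vmem L; first by rewrite cards0.
  by move=> _; have [_] := lines_at_full q; apply; rewrite inE lL.
have [cp _] := lines_at_full p.
have <- : #|lines_at p :\: line_through p @: (nbrs p :&: L)| = 1.
  rewrite cardsD (setIidPr _).
    rewrite card_in_imset ?off_line // ?cp.
      by case: (d) d_gt0 => // k _; rewrite subSnn.
    move=> y z; rewrite !inE => /andP[py yL] /andP[pz zL] e.
    apply/eqP/negPn/negP=> yz; have [l1 p1 y1] := line_throughP py.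
    have [_ _ z1] := line_throughP pz; rewrite -e in z1.
    by rewrite -(line_meet l1 lL yz y1 z1 yL zL) p1 in pL.
  apply/subsetP=> _ /imsetP[y + ->]; rewrite !inE => /andP[py _].
  by have := line_through_in py; rewrite inE.
apply: eq_card => M; rewrite in_setD [in LHS]inE andbC.
have [|_] := boolP (M \in lines_at p); rewrite ?andbF // !andbT inE.
case/andP=> lM pM.
apply/idP/idP=> [/disjoint_setI0 dML | nM].
  apply/imsetP=> -[y /setIP[]]; rewrite inE => py yL eM.
  have [_ _ yM] := line_throughP py; move/setP/(_ y): dML.
  by rewrite !inE eM yM yL.
apply/pred0P=> y /=; apply/negP=> /andP[yM yL]; case/imsetP: nM; exists y.
  rewrite !inE yL andbT (line_clique lM) //.
  by apply: contraNneq pL => ->.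
by rewrite (line_through_eq lM) //; apply: contraNneq pL => ->.
Qed.

(** [h x] is the unique line through [x] that is equal to a fixed line [L] or
    disjoint from it. *)
Lemma parallel_class : #|V| = n ^ 2 ->
  exists h : V -> {set V}, [/\ forall x, line (h x), forall x, x \in h x &
    forall x y, y \in h x -> h y = h x].
Proof.
move=> cV; have /card_gt0P[o _] : 0 < #|V| by rewrite cV sqrn_gt0 ltnW.
have [L lL] : exists L, line L.
  have /card_gt0P[q] : 0 < #|nbrs o|.
    by rewrite deg_eq muln_gt0 d_gt0; case: (n) n_gt1 => [|[]].
  by rewrite inE => /edge_line[L [lL _ _]]; exists L.
pose para x M := [&& line M, x \in M & (M == L) || [disjoint M & L]].
have ex x : exists M, para x M.
  have [xL | xL] := boolP (x \in L).
    by exists L; rewrite /para lL xL eqxx.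
  have /eqP/cards1P[M /setP/(_ M)] := one_parallel lL xL.
  rewrite !inE eqxx => /andP[/andP[lM xM] dM]; exists M.
  by rewrite /para lM xM dM orbT.
have uniq x M1 M2 : para x M1 -> para x M2 -> M1 = M2.
  case/and3P=> l1 x1 p1 /and3P[l2 x2 p2].
  have [xL | xL] := boolP (x \in L).
    have eqL (M : {set V}) : x \in M -> (M == L) || [disjoint M & L] -> M = L.
      move=> xM /orP[/eqP // | /pred0P/(_ x) /=]; by rewrite xM xL.
    by rewrite (eqL M1) // (eqL M2).
  have dL (M : {set V}) : x \in M -> (M == L) || [disjoint M & L] -> [disjoint M & L].
    by move=> xM /predU1P[eM | //]; rewrite -eM xM in xL.
  have /eqP/cards1P[M /setP eM] := one_parallel lL xL.
  have := eM M1; rewrite !inE l1 x1 dL // => /esym/eqP->.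
  by have := eM M2; rewrite !inE l2 x2 dL // => /esym/eqP->.
pose h x := xchoose (ex x); have hP x : para x (h x) := xchooseP (ex x).
exists h; split=> [x|x|x y yhx]; try by case/and3P: (hP x).
apply: uniq (hP y) _; case/and3P: (hP x) => lx xx px.
by rewrite /para lx yhx px.
Qed.

(** A parallel class has [n] lines, and [g] numbers them by the elements of [T]. *)
Lemma exists_parallel_row (T : finType) : #|V| = n ^ 2 -> #|T| = n ->
  exists g : V -> T, forall x y, x != y -> g x = g y -> adj x y.
Proof.
move=> cV cT; have [h [hl hin heq]] := parallel_class cV.
have /card_gt0P[t0 _] : 0 < #|T| by rewrite cT ltnW.
have ch x : #|h x| = n.
  by have [_] := lines_at_full x; apply; rewrite inE hl hin.
have cP' : #|h @: [set: V]| = n.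
  apply/eqP; rewrite -(eqn_pmul2r (ltnW n_gt1)) -[n * n]/(n ^ 2) -cV.
  rewrite -sum_nat_const -sum1_card.
  rewrite [X in _ == X](partition_big h (mem (h @: [set: V]))) /=; last first.
    by move=> x _; apply: imset_f; rewrite inE.
  apply/eqP/eq_bigr => _ /imsetP[x _ ->]; rewrite sum1dep_card -(ch x).
  apply: eq_card => y; rewrite inE; apply/idP/eqP=> [/heq // | <-].
  exact: hin.
pose idx x := index (h x) (enum (h @: [set: V])).
have hE x : h x \in enum (h @: [set: V]) by rewrite mem_enum imset_f ?inE.
have idx_lt x : idx x < size (enum T).
  by rewrite -cardE cT -cP' cardE index_mem.
exists (fun x => nth t0 (enum T) (idx x)) => x y xy /eqP.
rewrite nth_uniq ?enum_uniq // => /eqP /(congr1 (nth set0 (enum (h @: [set: V])))).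
rewrite !nth_index // => e; apply: line_clique (hl x) _ _ (hin x) _ xy.
by rewrite e.
Qed.

End Lines.

(** * The disagreement graph of an orthogonal array *)

Lemma card_indicator (V : finType) (P : pred V) : #|[set z | P z]| = \sum_z P z.
Proof.
by rewrite -sum1dep_card big_mkcond; apply: eq_bigr => z _; case: (P z).
Qed.


Section Net.

(** An orthogonal array with columns in [V], given by its rows. *)
Variables (V T : finType) (m n : nat) (F : 'I_m -> V -> T).
Hypothesis m_gt1 : 1 < m.
Hypothesis cardT : #|T| = n.
Hypothesis cardV : #|V| = n ^ 2.
Hypothesis F_inj : forall i j, i != j -> injective (fun c => (F i c, F j c)).

(** Two columns are adjacent when they agree in no row. *)
Definition disagree x y := [forall i, F i x != F i y].

(** The number of rows in which two columns agree. *)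
Definition agreements x y := #|[set i | F i x == F i y]|.

Lemma disagreeC : symmetric disagree.
Proof. by move=> x y; apply: eq_forallb => i; rewrite eq_sym. Qed.

Lemma disagreexx : irreflexive disagree.
Proof.
move=> x; apply/forallP=> /(_ (Ordinal (ltnW m_gt1))); by rewrite eqxx.
Qed.

Lemma agreementsE x y : agreements x y = \sum_i (F i x == F i y).
Proof.
by rewrite /agreements -sum1dep_card big_mkcond; apply: eq_bigr => i _; case: eqP.
Qed.

Lemma agreementsC x y : agreements x y = agreements y x.
Proof. by rewrite !agreementsE; apply: eq_bigr => i _; rewrite eq_sym. Qed.

Lemma agreementsxx x : agreements x x = m.
Proof.
by rewrite agreementsE (eq_bigr (fun=> 1)) ?sum1_card ?card_ord // => i; rewrite eqxx.
Qed.

Lemma card_fiber2 i j a b : i != j -> #|[set z | (F i z == a) && (F j z == b)]| = 1.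
Proof.
move=> ij; apply/eqP.
have inj := F_inj ij.
have : (a, b) \in codom (fun c => (F i c, F j c)).
  apply: inj_card_onto => //; by rewrite card_prod cardT cardV mulnn.
case/codomP=> z [-> ->]; apply/cards1P; exists z; apply/setP=> w; rewrite !inE.
apply/andP/eqP => [[/eqP e1 /eqP e2] | ->]; last by rewrite !eqxx.
by apply: inj; rewrite e1 e2.
Qed.

Lemma card_fiber i a : #|[set z | F i z == a]| = n.
Proof.
have [j ij] : exists j, i != j.
  have := ltnW m_gt1; have : exists j : 'I_m, j \in [set~ i].
    by apply/card_gt0P; rewrite cardsC1 card_ord; case: (m) m_gt1 => [|[]].
  by case=> j; rewrite !inE eq_sym => ij _; exists j.
rewrite -cardT -sum1dep_card (partition_big (F j) xpredT) //=.
rewrite -sum1_card; apply: eq_bigr => b _.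
by rewrite sum1dep_card card_fiber2.
Qed.

Lemma agreements_le1 x y : x != y -> agreements x y <= 1.
Proof.
move=> xy; rewrite leqNgt; apply/negP=> /card_gt1P[i [j []]].
rewrite !inE => /eqP ei /eqP ej ij; case/eqP: xy.
by apply: (F_inj ij); rewrite ei ej.
Qed.

Lemma disagreeE x y : disagree x y = (agreements x y == 0).
Proof.
rewrite /agreements cards_eq0; apply/forallP/eqP=> [H | /setP H i].
  by apply/setP=> i; rewrite !inE (negPf (H i)).
by have := H i; rewrite !inE => ->.
Qed.

Lemma sum_agreements x : \sum_z agreements x z = m * n.
Proof.
under eq_bigr do rewrite /agreements -sum1dep_card big_mkcond.
rewrite exchange_big /= -[m in RHS]card_ord -sum_nat_const; apply: eq_bigr => i _.
rewrite -(card_fiber i (F i x)) -sum1dep_card [RHS]big_mkcond.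
by apply: eq_bigr => z _; rewrite eq_sym.
Qed.

(** The ordered pairs of distinct rows account for one column each; a row paired
    with itself contributes [n] if [x] and [y] agree in it and nothing otherwise. *)
Lemma sum_agreements2 x y :
  \sum_z agreements x z * agreements y z = m * m.-1 + agreements x y * n.
Proof.
have -> : \sum_z agreements x z * agreements y z =
   \sum_i \sum_j #|[set z | (F i z == F i x) && (F j z == F j y)]|.
  transitivity (\sum_z \sum_i \sum_j ((F i z == F i x) && (F j z == F j y) : nat)).
    apply: eq_bigr => z _; rewrite !agreementsE.
    rewrite big_distrl /=; apply: eq_bigr => i _.
    rewrite big_distrr /=; apply: eq_bigr => j _.
    by rewrite ![F _ z == _]eq_sym; do 2!case: (_ == _).
  rewrite exchange_big /=; apply: eq_bigr => i _.
  rewrite exchange_big /=; apply: eq_bigr => j _.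
  by rewrite card_indicator.
transitivity (\sum_i (m.-1 + (F i x == F i y) * n)).
  apply: eq_bigr => i _; rewrite (bigD1 i) //= addnC; congr (_ + _).
    rewrite (eq_bigr (fun=> 1)) ?sum1_card ?cardC1 ?card_ord //.
    by move=> j ji; rewrite card_fiber2 // eq_sym.
  have [<- | nxy] := eqVneq (F i x) (F i y).
    rewrite mul1n -(card_fiber i (F i x)); apply: eq_card => z.
    by rewrite !inE andbb.
  apply: eq_card0 => z; rewrite !inE; apply/andP=> -[/eqP-> /eqP exy].
  by rewrite exy eqxx in nxy.
rewrite big_split /= sum_nat_const card_ord -big_distrl /=; congr (_ + _ * _).
by rewrite agreementsE.
Qed.

Let agree0 x y : x != y -> disagree x y + agreements x y = 1.
Proof.
by move=> xy; rewrite disagreeE; have := agreements_le1 xy; case: agreements => [|[]].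
Qed.

(** For [z] distinct from [x] and [y], the indicator of common neighbours is
    [(1 - agreements x z) * (1 - agreements y z)].  It is summed over all [z], the
    terms for [x] and [y] being corrected by hand; all terms are arranged so that
    no subtraction occurs. *)
Lemma card_common_disagree x y (e := agreements x y) : x != y ->
  #|nbrs disagree x :&: nbrs disagree y| + 2 * (m * n) + 2 * (1 + m * e) =
  n ^ 2 + (m * m.-1 + e * n) + 2 * (m + e).
Proof.
move=> xy; rewrite /e -sum_agreements2 -cardV -[#|V|]sum1_card -big_split /=.
rewrite [2 * (m * n)]mul2n -addnn -{1}(sum_agreements x) -(sum_agreements y).
have -> : nbrs disagree x :&: nbrs disagree y =
    [set z | disagree x z && disagree y z] by apply/setP=> z; rewrite !inE.
rewrite card_indicator addnA -!big_split /=.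
have yx : y != x by rewrite eq_sym.
rewrite (bigD1 x) //= (bigD1 y) //= [in RHS](bigD1 x) //= [in RHS](bigD1 y) //=.
rewrite !agreementsxx !disagreexx (agreementsC y x) -/e !andbF /=.
rewrite (eq_bigr (fun z => 1 + agreements x z * agreements y z)); last first.
  move=> z /andP[zx zy]; rewrite eq_sym in zx; rewrite eq_sym in zy.
  have := agree0 zx; have := agree0 zy.
  by case: disagree; case: disagree => /=; lia.
lia.
Qed.

Lemma clique_inj C i : clique disagree C -> {in C &, injective (F i)}.
Proof.
move=> /cliqueP cC x y xC yC; apply: contra_eq => xy.
by have /forallP := cC x y xC yC xy.
Qed.

Lemma clique_le C : clique disagree C -> #|C| <= n.
Proof.
move=> cC; rewrite -cardT -(card_in_imset (clique_inj (i := Ordinal (ltnW m_gt1)) cC)).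
exact: max_card.
Qed.

Variable d : nat.
Hypothesis md : m + d = n.+1.

Lemma card_disagree x : 0 < n -> #|nbrs disagree x| = d * n.-1.
Proof.
move=> n_gt0.
have : #|nbrs disagree x| + m * n + 1 = n ^ 2 + m.
  rewrite card_indicator -(sum_agreements x) -big_split /= -cardV -sum1_card.
  rewrite (bigD1 x) //= [in RHS](bigD1 x) //= agreementsxx disagreexx.
  rewrite (eq_bigr (fun=> 1)) => [|z zx]; last by rewrite agree0 // eq_sym.
  by rewrite add0n addn1 add1n addSn addnC.
move: md; case: n n_gt0 => // k _; nia.
Qed.

(** [L] has one point in each fibre of each row.  Hence [p] agrees with [m] points
    of [L], in one row each, and is adjacent to the others. *)
Lemma card_disagree_transversal L p : clique disagree L -> #|L| = n ->
  p \notin L -> #|nbrs disagree p :&: L| = d.-1.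
Proof.
move=> cL nL pL; suff : #|nbrs disagree p :&: L| + m = n by move: md; lia.
have card1 i : #|[set z in L | F i z == F i p]| = 1.
  have : F i p \in F i @: L.
    suff -> : F i @: L = setT by rewrite inE.
    apply/eqP; rewrite eqEcard subsetT cardsT cardT card_in_imset ?nL //=.
    exact: clique_inj cL.
  case/imsetP=> z zL ez; apply/eqP/cards1P; exists z; apply/setP=> w.
  rewrite !inE ez; apply/andP/eqP=> [[wL /eqP e]|->]; last by rewrite zL eqxx.
  exact: (clique_inj cL wL zL e).
rewrite -[in RHS]nL -[in RHS]sum1_card.
rewrite (eq_bigr (fun z => disagree p z + agreements p z)); last first.
  by move=> z zL; rewrite agree0 //; apply: contraNneq pL => ->.
rewrite big_split /=; congr (_ + _).
  rewrite -sum1_card big_mkcond [RHS]big_mkcond; apply: eq_bigr => z _.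
  by rewrite !inE andbC; case: (z \in L); case: disagree.
under [RHS]eq_bigr do rewrite agreementsE.
rewrite exchange_big /= (eq_bigr (fun=> 1)) ?sum1_card ?card_ord // => i _.
rewrite -(card1 i) -sum1_card big_mkcond [RHS]big_mkcond.
by apply: eq_bigr => z _; rewrite inE eq_sym; case: (z \in L); case: (_ == _).
Qed.

End Net.

(** * The numerical conditions *)

(** Here [e = d - 1], and [s + 1 = floor((4d - 1) / 3)] is the bound [M] on claws.
    The first condition, which is tight when 3 divides [e], says that lines meet in
    at most one point; the second one bounds claws; the third one forces the lines
    to have size [n].  The proof splits according to [e] modulo 3. *)
Lemma claw_parameters e n (s := (4 * e) %/ 3) (c := (e.+1 * e).-1)
    (lam := n - 2 + e ^ 2 - e) :
    1 < n -> 8 * e ^ 3 + 8 * e ^ 2 < 3 * n + 2 * e ->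
  [/\ (s + s.+1) * c <= lam,
      e.+1 * n.-1 + 'C(s.+2, 2) * c < s.+2 * lam.+1
    & e.+1 * n.-1 + e.+2 * s ^ 2 < e.+2 * lam.+1].
Proof.
move=> n_gt1 n_big.
have [b eb] : exists b, e ^ 2 = e + b.
  by exists (e * e.-1); case: (e) => //= k; rewrite -mulnn; lia.
have [k en] : exists k, n = k.+2 by exists (n - 2); lia.
have -> : lam = k + b by rewrite /lam eb en; lia.
have C2 : 'C(s.+2, 2) * 2 = s.+2 * s.+1.
  by rewrite (bin_ffact s.+2 2) ffactnS ffactn1.
have [t [r [r3 et]]] : exists t r, r < 3 /\ e = 3 * t + r.
  by exists (e %/ 3), (e %% 3); rewrite ltn_mod {1}(divn_eq e 3) mulnC.
(* The case [e = 0] is apart because [c] is then a truncated predecessor. *)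
have [t0 | t_gt0] := posnP e.
  have c0 : c = 0 by rewrite /c t0.
  have s0 : s = 0 by rewrite /s t0.
  have b0 : b = 0 by move: eb; rewrite t0; lia.
  by rewrite c0 s0 b0 t0 en; split; lia.
have ec : c = e + e + b - 1 by rewrite /c mulSn mulnn eb; lia.
have est : s = 4 * t + r by rewrite /s; lia.
move: C2; set C := 'C(_, 2) => C2.
have {}C2 : 2 * (C * c) = s.+2 * s.+1 * c by rewrite mulnA [2 * C]mulnC C2.
move: C2; set D := C * c => C2; clearbody D C s c; clear C lam.
have {}eb : e * e = e + b by rewrite mulnn.
have {}n_big : 8 * (e * e * e) + 8 * (e * e) < 3 * n + 2 * e.
  by rewrite -mulnA mulnn -expnS.
rewrite -mulnn; case: r r3 et est => [|[|[|//]]] _ et est.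
(* In each case [k] is its least possible value plus some [j], and the conditions
   become comparisons of polynomials with coefficients in [nat]. *)
- have [u tu] : exists u, t = u.+1 by exists t.-1; lia.
  move: n_big; rewrite en et tu => n_big.
  have [j ej] : exists j, k = 72 * (u * u * u) + 240 * (u * u) + 262 * u + 93 + j.
    exists (k - (72 * (u * u * u) + 240 * (u * u) + 262 * u + 93)); lia.
  have {}eb : b = 9 * (u * u) + 15 * u + 6 by rewrite et ?tu in eb; lia.
  rewrite et ?tu {et} in est ec *; rewrite est ec ?tu eb ej {est ec eb ej n_big} in C2 *.
  by split; lia.
- move: n_big; rewrite en et => n_big.
  have [j ej] : exists j, k = 72 * (t * t * t) + 96 * (t * t) + 38 * t + 3 + j.
    exists (k - (72 * (t * t * t) + 96 * (t * t) + 38 * t + 3)); lia.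
  have {}eb : b = 9 * (t * t) + 3 * t by rewrite et ?tu in eb; lia.
  rewrite et ?tu {et} in est ec *; rewrite est ec ?tu eb ej {est ec eb ej n_big} in C2 *.
  by split; lia.
- move: n_big; rewrite en et => n_big.
  have [j ej] : exists j, k = 72 * (t * t * t) + 168 * (t * t) + 126 * t + 29 + j.
    exists (k - (72 * (t * t * t) + 168 * (t * t) + 126 * t + 29)); lia.
  have {}eb : b = 9 * (t * t) + 9 * t + 2 by rewrite et ?tu in eb; lia.
  rewrite et ?tu {et} in est ec *; rewrite est ec ?tu eb ej {est ec eb ej n_big} in C2 *.
  by split; lia.
Qed.

(** * Adding rows *)

Lemma extend_row (V T : finType) (m n e : nat) (F : 'I_m -> V -> T) :
    1 < n -> 1 < m -> m + e = n -> #|T| = n -> #|V| = n ^ 2 ->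
    (forall i j, i != j -> injective (fun c => (F i c, F j c))) ->
    8 * e ^ 3 + 8 * e ^ 2 < 3 * n + 2 * e ->
  exists g : V -> T, forall i, injective (fun c => (F i c, g c)).
Proof.
move=> n_gt1 m_gt1 men cardT cardV F_inj n_big.
have [] := claw_parameters n_gt1 n_big.
set s := (4 * e) %/ 3; set c := (e.+1 * e).-1; set lam := n - 2 + e ^ 2 - e.
move=> lam_big deg_small d_small.
have md : m + e.+1 = n.+1 by rewrite addnS men.
pose adj := disagree F.
have lamP x y : adj x y -> #|nbrs adj x :&: nbrs adj y| = lam.
  move=> xy; have := card_common_disagree m_gt1 cardT cardV F_inj
    (adj_neq (disagreexx F m_gt1) xy).
  move: xy; rewrite /adj disagreeE => /eqP->; rewrite /lam -men -!mulnn.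
  set D := #|_|; clearbody D; clear -m_gt1; nia.
have cP x y : x != y -> ~~ adj x y -> #|nbrs adj x :&: nbrs adj y| <= c.+1.
  move=> xy nxy; have := card_common_disagree m_gt1 cardT cardV F_inj xy.
  have -> : agreements F x y = 1.
    move: nxy (agreements_le1 F_inj xy); rewrite /adj disagreeE.
    by case: agreements => [|[]].
  rewrite /c -men -!mulnn; set D := #|_|; clearbody D; clear -m_gt1; nia.
have deg x := card_disagree m_gt1 cardT cardV F_inj md x (ltnW n_gt1).
have [|||g gP] := @exists_parallel_row V adj lam c s (disagreeC F)
  (disagreexx F m_gt1) lamP cP lam_big _ n e.+1 n_gt1 deg _ d_small _ isT T cardV cardT.
- by move=> x; rewrite deg.
- exact: clique_le m_gt1 cardT.
- move=> L p /andP[/maxsetp cL _]; exact: card_disagree_transversal.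
exists g => i x y [exy /gP gxy]; apply: contraPeq exy => /gxy/forallP/(_ i).
by move/eqP.
Qed.

(** The matrix [A] with [g] as an additional last row. *)
Definition add_row (T : finType) (m k : nat) (A : 'M[T]_(m, k)) (g : 'I_k -> T) :
    'M[T]_(m.+1, k) :=
  \matrix_(i, c) if unlift ord_max i is Some j then A j c else g c.

Lemma add_row_old (T : finType) m k (A : 'M[T]_(m, k)) g (le_m : m <= m.+1) i :
  row (widen_ord le_m i) (add_row A g) = row i A.
Proof.
have -> : widen_ord le_m i = lift ord_max i.
  by apply: val_inj; rewrite /= /bump leqNgt ltn_ord.
by apply/rowP=> c; rewrite !mxE liftK.
Qed.

Lemma orthogonal_array_add_row (T : finType) m n (A : 'M[T]_(m, n ^ 2)) g :
    orthogonal_array n A -> (forall i, injective (fun c => (A i c, g c))) ->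
  orthogonal_array n (add_row A g).
Proof.
move=> [cT oaA] Ag; split=> // i j ij x y.
rewrite !mxE; case: unliftP ij => [i' ->|->]; case: unliftP => [j' ->|->] ij [e1 e2].
- by apply: (oaA i' j') => [|//]; rewrite ?e1 ?e2 //; apply: contraNneq ij => ->.
- by apply: (Ag i'); rewrite e1 e2.
- by apply: (Ag j'); rewrite e1 e2.
- by rewrite eqxx in ij.
Qed.

(** The numerical hypothesis is the one of [orthogonal_array_complete], with
    [e = d - 1]. *)
Lemma orthogonal_array_extend (T : finType) m n e (A : 'M[T]_(m, n ^ 2)) :
    0 < m -> m + e = n -> 8 * e ^ 3 + 8 * e ^ 2 < 3 * n + 2 * e ->
    orthogonal_array n A ->
  exists g, orthogonal_array n (add_row A g).
Proof.
move=> m_gt0 men n_big oaA; have [cT A_inj] := oaA.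
have n_gt0 : 0 < n by rewrite -men ltn_addr.
suff [g gP] : exists g : 'I_(n ^ 2) -> T,
    forall i, injective (fun c => (A i c, g c)).
  by exists g; apply: orthogonal_array_add_row.
(* For [n = 1] there is only one column, and any row will do. *)
have [n_gt1 | n_le1] := ltnP 1 n; last first.
  have [t _] : exists t : T, t \in T by apply/card_gt0P; rewrite cT.
  have n1 : n ^ 2 <= 1 by rewrite -(exp1n 2) leq_sqr.
  exists (fun=> t) => i x y _; apply: val_inj => /=.
  have := leq_trans (ltn_ord x) n1; have := leq_trans (ltn_ord y) n1.
  by rewrite !ltnS !leqn0 => /eqP-> /eqP->.
apply: (extend_row (n := n) (e := e)); rewrite ?card_ord //.
(* With a single row [e = n - 1], and the bound fails for [n > 1]. *)
rewrite ltnNge; apply/negP=> m_le1.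
have m1 : m = 1 by lia.
by move: n_big; rewrite -men m1; move: n_gt1; rewrite -men m1 !expnS; nia.
Qed.

(** Induction on the deficiency [d]. *)
Lemma orthogonal_array_complete (T : finType) (n d m : nat) (le_mn : m <= n.+1)
    (A : 'M[T]_(m, n ^ 2)) :
    0 < m -> 0 < n -> m + d = n.+1 ->
    8 * d ^ 3 + 6 * d + 2 < 3 * n + 16 * d ^ 2 ->
    orthogonal_array n A ->
  exists B : 'M[T]_(n.+1, n ^ 2), orthogonal_array n B /\
    forall i : 'I_m, row (widen_ord le_mn i) B = row i A.
Proof.
move=> + n_gt0; elim: d m le_mn A => [|e IH] m le_mn A m_gt0 md n_big oaA.
  rewrite addn0 in md; subst m; exists A; split=> // i; congr (row _ A).
  exact: val_inj.
have men : m + e = n by lia.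
have [|g oaA'] := @orthogonal_array_extend T m n e A m_gt0 men _ oaA.
  by move: n_big; rewrite !expnS !expn0; nia.
have le_m'n : m.+1 <= n.+1 by rewrite -men ltnS leq_addr.
have [|||B [oaB BA]] := IH m.+1 le_m'n (add_row A g) _ _ _ oaA'.
- by [].
- by rewrite addSn men.
- by move: n_big; rewrite !expnS !expn0; case: (e) => [|k]; nia.
exists B; split=> // i; rewrite -(add_row_old A g (leqnSn m)) -BA.
by congr (row _ B); apply: val_inj.
Qed.

Import Order.TTheory GRing.Theory Num.Theory.
Local Open Scope ring_scope.

Theorem corollaryA1 (m n : nat) (m_gt0 : (0 < m)%N) (n_gt0 : (0 < n)%N)
    (le_mn : (m <= n.+1)%N) (T : finType) (A : 'M[T]_(m, (n ^ 2)%N))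
    (oaA : orthogonal_array n A) :
  let delta : rat := n%:R - m%:R + 1 in
  n%:R > 8%:R / 3%:R * delta ^+ 3 - 16%:R / 3%:R * delta ^+ 2
         + 2%:R * delta + 2%:R / 3%:R ->
  exists B : 'M[T]_(n.+1, (n ^ 2)%N),
    orthogonal_array n B /\
    (forall i : 'I_m, row (widen_ord le_mn i) B = row i A).
Proof.
move=> delta n_big; pose d := (n.+1 - m)%N.
have deltaE : delta = d%:R by rewrite /delta /d natrB // -natr1; ring.
apply: (@orthogonal_array_complete T n d) => //; first by rewrite subnKC.
rewrite -(ltr_nat rat) !natrD !natrM; move: n_big; rewrite deltaE; lra.
Qed.
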